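(* For all integers $n\ge 2$ there exists an $n$-good set $A$ with $\#A=\mathcal{O}(\sqrt{n})$ and $U_A=\{0,2\}$. That is, there is an absolute constant $K>0$ such that for every integer $n\ge 2$ there exists an $n$-good set $A$ with $\#A\le K\sqrt{n}$ and $U_A=\{0,2\}$.
   Context: For an integer $n\ge 2$ and a set $A$ of integers with $0,n-1\in A\subset\{0,1,\dots,n-1\}$, $C_A=C_{A,n}=\left\{\sum_{i=1}^\infty a_i n^{-i} : a_i\in A\right\}$, which is the attractor of the iterated function system $\{x\mapsto (x+a)/n : a\in A\}$. The sign $+$ between sets denotes the Minkowski sum. The set $A$ is called $n$-good if $0,n-1\in A\subset\{0,1,\dots,n-1\}$ and $C_A+C_A=[0,2]$. $U_A$ (the set of uniqueness) is the set of $z\in C_A+C_A$ for which there is exactly one ordered pair $(x,y)\in C_A\times C_A$ with $z=x+y$. $\#A$ denotes the cardinality of $A$. *)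

(* Defs.v *)
From HB Require Import structures.
From mathcomp Require Import all_boot all_order all_algebra finmap.
From mathcomp Require Import all_classical all_reals all_analysis.
Import Order.TTheory GRing.Theory Num.Theory numFieldNormedType.Exports.

Set Implicit Arguments.
Unset Strict Implicit.
Unset Printing Implicit Defensive.

Local Open Scope classical_set_scope.
Local Open Scope ring_scope.

(* The sequence a is indexed from 0, so its i-th term has weight n ^ -(i + 1). *)
Definition digit_set (R : realType) (n : nat) (A : {fset nat}) : set R :=
  [set x | exists2 a : nat -> nat, (forall i, a i \in A) &
     series (fun i => (a i)%:R * (n%:R : R) ^- i.+1) @ \oo --> x].
Arguments digit_set : clear implicits.

Definition minkowski_sum (R : realType) (X Y : set R) : set R :=
  [set x + y | x in X & y in Y].

(* Digits are natural numbers, so the upper bound alone says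
   that A is a subset of {0, ..., n - 1}. *)
Definition digits (n : nat) (A : {fset nat}) : Prop :=
  [/\ 0%N \in A, n.-1 \in A & forall a, a \in A -> (a < n)%N].

Definition good (R : realType) (n : nat) (A : {fset nat}) : Prop :=
  digits n A /\
  minkowski_sum (digit_set R n A) (digit_set R n A) = `[0, 2]%classic.
Arguments good : clear implicits.

Definition uniqueness_set (R : realType) (n : nat) (A : {fset nat}) : set R :=
  [set z | minkowski_sum (digit_set R n A) (digit_set R n A) z /\
     exists! p : R * R,
       [/\ digit_set R n A p.1, digit_set R n A p.2 & z = p.1 + p.2]].
Arguments uniqueness_set : clear implicits.

(* Main.v *)
Require Import Defs.
From HB Require Import structures.
From mathcomp Require Import all_boot all_order all_algebra finmap.
From mathcomp Require Import all_classical all_reals all_analysis.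
From mathcomp Require Import zify ring lra.
Import Order.TTheory GRing.Theory Num.Theory numFieldNormedType.Exports.

Set Implicit Arguments.
Unset Strict Implicit.
Unset Printing Implicit Defensive.

Local Open Scope classical_set_scope.
Local Open Scope ring_scope.

(** If [a] and [b] are the digit sequences of [x] and [y], exchanging the
    digits [a j] and [b j] at a single place keeps [x + y] and changes [x] as
    soon as [a j <> b j].  So a sum is non-unique once it has an expansion in
    which some digit [d] of [A + A] arises as [a + b] with [a <> b].

    It is therefore enough to find [A] such that every integer strictly between
    [0] and [2n - 2] is a sum of two distinct elements of [A]
    ([spans_distinctly]).  Expand [z] in [0, 2] greedily: a remainder [r] in
    [0, 2] is sent to [n r - d] with [d] in [A + A] keeping the remainder in
    [0, 2].  If [1 <= n r <= 2n - 1], a digit [d] with [0 < d < 2n - 2] is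
    available, and it splits into distinct summands ([digit_step_exists]).
    Otherwise [n r] is within [1] of an end of [0, 2n], the digit is [0] or
    [2n - 2], and the distance from [r] to [{0, 2}] gets multiplied by [n].
    That cannot go on forever unless [z] is [0] or [2] ([distinct_digit]).
    These two points are unique sums because the attractor lies in [0, 1].

    Such an [A] with [O(sqrt n)] elements comes from Euclidean division by [m],
    the integer square root of [n]: a residue below [m] and a multiple of [m]
    add up to any given integer from [1] to [n - 1], and the mirror images
    under [a |-> n - 1 - a] give the larger sums ([thin_digits_span]). *)

(** * Digit sets with few elements and many sums *)

Definition spans_distinctly (n : nat) (A : {fset nat}) : Prop :=
  forall s : nat, (0 < s < n.-1.*2)%N ->
    exists a b : nat, [/\ a \in A, b \in A, a != b & (a + b)%N = s].

(** The bound [m.+2] on the multipliers suffices when [n < (m + 1)^2], since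
    then [m q < n] forces [q < m + 2]. *)
Definition half_digits (m : nat) : seq nat :=
  (iota 0 m ++ map (muln m) (iota 0 m.+2))%SEQ.

Definition thin_digits (n m : nat) : {fset nat} :=
  let half := half_digits m in
  [fset x in [seq x <- half ++ map (subn n.-1) half | (x < n)%N]]%fset.

Lemma thin_digitsP (n m x : nat) : (0 < m)%N -> (0 < n < m.+1 ^ 2)%N ->
  (x < n)%N -> ((x < m)%N || (m %| x)%N) ->
  (x \in thin_digits n m) /\ ((n.-1 - x)%N \in thin_digits n m).
Proof.
move=> m0 nm xn hx; rewrite /thin_digits.
have xh : x \in half_digits m.
  rewrite mem_cat mem_iota; case/orP: hx => [->//|/dvdnP[q xE]].
  apply/orP; right; apply/mapP; exists q; last by rewrite xE mulnC.
  rewrite mem_iota /=; nia.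
split; rewrite in_fset_ /= mem_filter mem_cat.
  by rewrite xn xh.
by rewrite map_f // orbT andbT; lia.
Qed.

Lemma thin_digits_lt (n m x : nat) : x \in thin_digits n m -> (x < n)%N.
Proof. by rewrite in_fset_ /= mem_filter => /andP[]. Qed.

Lemma card_thin_digits (n m : nat) : (0 < m)%N ->
  (#|` thin_digits n m| <= 8 * m)%N.
Proof.
move=> m0; rewrite card_fseq (leq_trans (size_undup _))//.
rewrite size_filter (leq_trans (count_size _ _))//.
by rewrite !(size_cat, size_map, size_iota); lia.
Qed.

(** A sum [0 < s <= n - 1] is [(s / m) m + s mod m]; the summands could only be
    equal if both vanished, as [s mod m < m].  Larger sums are obtained by
    applying this to [2n - 2 - s] and reflecting both summands. *)
Lemma thin_digits_span (n m : nat) : (0 < m)%N -> (0 < n < m.+1 ^ 2)%N ->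
  spans_distinctly n (thin_digits n m).
Proof.
move=> m0 nm.
have small s : (0 < s <= n.-1)%N -> exists a b : nat,
    [/\ a \in thin_digits n m /\ (n.-1 - a)%N \in thin_digits n m,
        b \in thin_digits n m /\ (n.-1 - b)%N \in thin_digits n m,
        a != b, (a + b)%N = s & (a < n)%N && (b < n)%N].
  move=> /andP[s0 sn].
  have sE := divn_eq s m; have rm : (s %% m < m)%N by rewrite ltn_mod.
  have qs := leq_divM s m; have rs := leq_mod s m.
  have sn' : (s < n)%N by lia.
  exists (s %/ m * m)%N, (s %% m)%N; split.
  - apply: thin_digitsP => //; first exact: leq_ltn_trans qs _.
    by rewrite dvdn_mull ?orbT.
  - by apply: thin_digitsP => //; [exact: leq_ltn_trans rs _|rewrite rm].
  - apply/eqP => E; move: sE rm; rewrite -E.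
    by case: (s %/ m)%N => [|q]; rewrite ?mulSn; lia.
  - by [].
  - by rewrite (leq_ltn_trans qs) ?(leq_ltn_trans rs).
move=> s hs; have [sn|sn] := leqP s n.-1.
  have [|a [b [[? _] [? _] ? ? _]]] := small s; first by lia.
  by exists a, b.
have [|a [b [[_ ?] [_ ?] ? ? ?]]] := small (n.-1.*2 - s)%N; first by lia.
by exists (n.-1 - a)%N, (n.-1 - b)%N; split => //; lia.
Qed.

Lemma exists_thin_digits (n : nat) : (2 <= n)%N ->
  exists (A : {fset nat}) (m : nat),
    [/\ digits n A, spans_distinctly n A, (m ^ 2 <= n)%N &
        (#|` A| <= 8 * m)%N].
Proof.
move=> n2.
have ub i : (i ^ 2 <= n)%N -> (i <= n)%N by nia.
have ex0 : exists i : nat, (i ^ 2 <= n)%N by exists 0%N.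
case: (ex_maxnP ex0 ub) => m mn mmax.
have m0 : (0 < m)%N by apply: mmax; lia.
have nm : (0 < n < m.+1 ^ 2)%N.
  by apply/andP; split; [lia|rewrite ltnNge; apply/negP => /mmax; lia].
exists (thin_digits n m), m; split => //.
- have [| |h0 hn] := @thin_digitsP n m 0%N m0 nm; [by lia|by rewrite m0|].
  by split => //; [rewrite subn0 in hn|exact: thin_digits_lt].
- exact: thin_digits_span.
- exact: card_thin_digits.
Qed.

(** * Expansions with digits in a finite set *)

Definition expansion (R : realType) (n : nat) (a : nat -> nat) : R ^nat :=
  series (fun i => (a i)%:R * (n%:R : R) ^- i.+1).
Arguments expansion : clear implicits.

Section expansion.
Variables (R : realType) (n : nat).
Hypothesis n_ge2 : (2 <= n)%N.

Let n_gt0 : (0 : R) < n%:R. Proof. by rewrite ltr0n; lia. Qed.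

Lemma expansionS (a : nat -> nat) (k : nat) :
  expansion R n a k.+1 = expansion R n a k + (a k)%:R * n%:R ^- k.+1.
Proof. by rewrite /expansion /series /= big_nat_recr. Qed.

Lemma expansion_ge0 (a : nat -> nat) (k : nat) : 0 <= expansion R n a k.
Proof.
by apply: sumr_ge0 => i _; rewrite mulr_ge0 ?invr_ge0 ?exprn_ge0 ?ler0n.
Qed.

(** The bound is the partial sum for the largest digit, [n - 1], at every
    place; the telescoping remainder [n ^- k] makes the induction go through. *)
Lemma expansion_le (a : nat -> nat) (k : nat) : (forall i, a i < n)%N ->
  expansion R n a k <= 1 - n%:R ^- k.
Proof.
move=> an; elim: k => [|k IH].
  by rewrite /expansion /series /= big_geq // expr0 invr1 subrr.
rewrite expansionS; apply: (le_trans (lerD IH (lexx _))).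
have -> : (n%:R : R) ^- k = n%:R * n%:R ^- k.+1.
  by rewrite exprS invfM mulrA mulfV ?mul1r// gt_eqF.
have : (a k)%:R + 1 <= n%:R :> R by rewrite natr1 ler_nat.
have : (0 : R) < n%:R ^- k.+1 by rewrite invr_gt0 exprn_gt0.
move: (n%:R ^- k.+1) => u; move: (_%:R) (_%:R) => c d; nra.
Qed.

Lemma cvg_expansion (a : nat -> nat) : (forall i, a i < n)%N ->
  cvgn (expansion R n a).
Proof.
move=> an; apply: nondecreasing_is_cvgn.
  apply/nondecreasing_seqP => k; rewrite expansionS lerDl.
  by rewrite mulr_ge0 ?invr_ge0 ?exprn_ge0 ?ler0n.
exists 1 => _ [k _ <-]; apply: (le_trans (expansion_le _ an)).
by rewrite gerBl invr_ge0 exprn_ge0 // ltW.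
Qed.

Lemma digit_set_itv (A : {fset nat}) (x : R) :
  (forall a, a \in A -> (a < n)%N) -> digit_set R n A x -> 0 <= x <= 1.
Proof.
move=> An [a aA]; rewrite -/(expansion R n a) => ax.
have xE := cvg_lim (@Rhausdorff R) ax.
have ca : cvgn (expansion R n a) by apply: cvgP ax.
rewrite -xE; apply/andP; split.
  by apply: limr_ge => //; apply: nearW => k; exact: expansion_ge0.
apply: limr_le => //; apply: nearW => k.
apply: (le_trans (expansion_le _ _)) => [i|]; first exact: An.
by rewrite gerBl invr_ge0 exprn_ge0 // ltW.
Qed.

Lemma digit_set_lim (A : {fset nat}) (a : nat -> nat) :
  (forall a, a \in A -> (a < n)%N) -> (forall i, a i \in A) ->
  digit_set R n A (limn (expansion R n a)).
Proof.
by move=> An aA; exists a => //; apply: cvg_expansion => i; exact: An.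
Qed.

(** The partial sums of the two sequences differ by a constant from the index
    [j + 1] on. *)
Lemma lim_expansion_swap (a b : nat -> nat) (j : nat) :
  (forall i, a i < n)%N -> (forall i, b i < n)%N ->
  limn (expansion R n (fun i => if i == j then b i else a i)) =
  limn (expansion R n a) + ((b j)%:R - (a j)%:R) * n%:R ^- j.+1.
Proof.
move=> an bn; apply/(cvg_lim (@Rhausdorff R)).
set c := _ * n%:R ^- _.
have near_sum : \forall k \near \oo,
    expansion R n a k + c =
    expansion R n (fun i => if i == j then b i else a i) k.
  near=> k.
  have jk : (j < k)%N by near: k; exact: nbhs_infty_gt.
  transitivity (expansion R n a k +
      \sum_(0 <= i < k | i == j) ((b i)%:R - (a i)%:R) * n%:R ^- i.+1).
    by rewrite big_nat1_eq /= jk.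
  rewrite [X in _ + X]big_mkcond -big_split /=; apply: eq_bigr => i _.
  by case: eqP => _; rewrite ?addr0//; ring.
apply: (cvg_trans (near_eq_cvg near_sum)).
by apply: cvgD; [exact: cvg_expansion|exact: cvg_cst].
Unshelve. all: by end_near.
Qed.

End expansion.

(** * The sum of two copies of the attractor *)

Section sums.
Variables (R : realType) (n : nat) (A : {fset nat}).
Hypotheses (n_ge2 : (2 <= n)%N) (An : digits n A).
Hypothesis Aspan : spans_distinctly n A.

Let A_lt a : a \in A -> (a < n)%N. Proof. by case: An => _ _; apply. Qed.

Let n_gt0 : (0 : R) < n%:R. Proof. by rewrite ltr0n; lia. Qed.

Let natr_ge2 : (2 : R) <= n%:R. Proof. by rewrite ler_nat. Qed.

Let K_gt0 : (1 < n.-1.*2)%N. Proof. by lia. Qed.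

Let natrK : (n.-1.*2)%:R = 2 * (n%:R : R) - 2.
Proof. by rewrite -muln2 natrM -subn1 natrB ?(ltnW n_ge2)//; ring. Qed.

(** One step of the greedy expansion at the remainder [z].  The last clause
    allows equal summands only next to [0] and [2], where the step multiplies
    the distance from the remainder to that endpoint by [n]. *)
Definition digit_step (z : R) (ab : nat * nat) : Prop :=
  [/\ ab.1 \in A, ab.2 \in A,
      0 <= n%:R * z - (ab.1 + ab.2)%:R <= 2 &
      ab.1 = ab.2 -> n%:R * z < 1 \/ 2 * n%:R - 1 < n%:R * z].

Lemma digit_step_exists (z : R) : 0 <= z <= 2 -> exists ab, digit_step z ab.
Proof.
move=> /andP[z0 z2]; have [A0 An1 _] := An.
have nz0 : 0 <= n%:R * z by rewrite mulr_ge0 // ltW.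
have nz2 : n%:R * z <= 2 * n%:R by rewrite mulrC ler_pM2r.
have [lo|lo] := ltP (n%:R * z) 1.
  exists (0, 0)%N; split => //=; [|by left].
  by rewrite addn0; apply/andP; split; lra.
have [hi|hi] := ltP (2 * n%:R - 1) (n%:R * z).
  exists (n.-1, n.-1); split => //=; [|by right].
  by rewrite addnn natrK; apply/andP; split; lra.
(* The integer part of [n z], capped so that the sum [2n - 2] is avoided. The
   cap costs nothing since [n z <= 2n - 1]. *)
pose s := minn (Num.trunc (n%:R * z)) (n.-1.*2).-1.
have /andP[t1 t2] := truncn_itv nz0.
have t_gt0 : (0 < Num.trunc (n%:R * z))%N.
  by rewrite -ltnS -(ltr_nat R) (le_lt_trans lo).
have predK : (n.-1.*2).-1%:R = 2 * (n%:R : R) - 3.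
  by rewrite -subn1 natrB ?(ltnW K_gt0) // natrK; ring.
have [|a [b [aA bA ab sE]]] := Aspan (s := s).
  rewrite leq_min t_gt0 gtn_min ltn_predL (ltnW K_gt0) orbT andbT.
  by rewrite -ltnS prednK // ltnW.
exists (a, b); split => //=; last by move=> E; rewrite E eqxx in ab.
rewrite sE /s /minn; case: ifPn => [lt|].
  by move: t2; rewrite -natr1; lra.
rewrite -leqNgt -(ler_nat R) predK; lra.
Qed.

Lemma greedy_digits (z : R) : 0 <= z <= 2 ->
  exists (a b : nat -> nat) (r : R ^nat),
    [/\ forall i, digit_step (r i) (a i, b i), r 0%N = z &
        forall i, r i.+1 = n%:R * r i - (a i + b i)%:R].
Proof.
move=> z02.
have /choice[f fP] (w : R) : exists ab, 0 <= w <= 2 -> digit_step w ab.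
  have [/digit_step_exists[ab abP]|] := boolP (0 <= w <= 2).
    by exists ab.
  by exists (0, 0)%N.
pose r := fix r k := if k is k'.+1
  then n%:R * r k' - ((f (r k')).1 + (f (r k')).2)%:R else z.
have r02 k : 0 <= r k <= 2.
  by elim: k => [//|k /fP[]].
exists (fun i => (f (r i)).1), (fun i => (f (r i)).2), r; split => // i.
by rewrite -surjective_pairing; exact: fP.
Qed.

Lemma greedy_bounds (a b : nat -> nat) (r : R ^nat) :
  (forall i, digit_step (r i) (a i, b i)) ->
  (forall i, r i.+1 = n%:R * r i - (a i + b i)%:R) ->
  forall i, 0 <= r i <= 2.
Proof.
move=> rP rS i; have [_ _ /andP[lo hi] _] := rP i; move: lo hi => /= lo hi.
have : (0 : R) <= (a i + b i)%:R by [].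
have : ((a i + b i)%:R : R) <= 2 * n%:R - 2.
  rewrite -natrK ler_nat; case: (rP i) => /A_lt /= ? /A_lt /= ? _ _; lia.
move: (_%:R) (r i) lo hi => s ri lo hi s2 s0.
by apply/andP; split; nra.
Qed.

(** After [k] steps the part of [r 0] not yet accounted for is [r k * n ^- k],
    which tends to [0] because the remainders stay in [0, 2]. *)
Lemma greedy_sum (a b : nat -> nat) (r : R ^nat) :
  (forall i, digit_step (r i) (a i, b i)) ->
  (forall i, r i.+1 = n%:R * r i - (a i + b i)%:R) ->
  limn (expansion R n a) + limn (expansion R n b) = r 0%N.
Proof.
move=> rP rS.
have aA i : (a i < n)%N by case: (rP i) => /A_lt.
have bA i : (b i < n)%N by case: (rP i) => _ /A_lt.
have r02 := greedy_bounds rP rS.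
have partial k :
    expansion R n a k + expansion R n b k = r 0%N - r k * n%:R ^- k.
  elim: k => [|k IH].
    by rewrite /expansion /series /= !big_geq // expr0 invr1; ring.
  rewrite !expansionS addrACA IH rS natrD exprS invfM.
  have nn : (n%:R : R) * n%:R^-1 = 1 by rewrite mulfV // gt_eqF.
  ring: nn.
have r_bnd k : `|r k * n%:R ^- k| <= 2 * (n%:R^-1) ^+ k.
  have u0 : (0 : R) <= n%:R ^- k by rewrite invr_ge0 exprn_ge0 // ltW.
  have /andP[rk0 rk2] := r02 k.
  by rewrite exprVn normrM !ger0_norm // ler_wpM2r.
have r_cvg0 : r k * n%:R ^- k @[k --> \oo] --> 0.
  apply/norm_cvg0P; apply: (squeeze_cvgr (f := cst 0)
    (h := geometric 2 (n%:R^-1 : R))); last 2 first.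
  - exact: cvg_cst.
  - apply: cvg_geometric; rewrite ger0_norm ?invr_ge0 ?ltW//.
    by rewrite invf_lt1 // ltr1n.
  by apply: nearW => k /=; rewrite normr_ge0 r_bnd.
have sum_cvg : expansion R n a k + expansion R n b k @[k --> \oo] --> r 0%N.
  under eq_cvg do rewrite partial.
  have := cvgB (cvg_cst (r 0%N)) r_cvg0; rewrite subr0; exact.
rewrite -(cvg_lim (@Rhausdorff R) sum_cvg) limD //; exact: cvg_expansion.
Qed.

(** With equal digits at every place, the distance [w] from the remainder to
    [{0, 2}] would be multiplied by at least [n] at each step, against
    [w <= 2]. *)
Lemma distinct_digit (a b : nat -> nat) (r : R ^nat) :
  (forall i, digit_step (r i) (a i, b i)) ->
  (forall i, r i.+1 = n%:R * r i - (a i + b i)%:R) ->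
  0 < r 0%N < 2 -> exists i, a i <> b i.
Proof.
move=> rP rS /andP[z0 z2]; apply/not_existsP => ab.
have eqab i : a i = b i by apply/not_notP; exact: ab.
have r02 := greedy_bounds rP rS.
pose w i := Order.min (r i) (2 - r i).
have wS i : n%:R * w i <= w i.+1.
  have [/A_lt /= aA _ _] := rP i; rewrite /= => /(_ (eqab i)) lo_hi.
  have := r02 i.+1; have := r02 i; rewrite /w rS -eqab => /andP[ri0 ri2].
  case: lo_hi => [lo|hi] /andP[r'0 r'2].
    (* As [n r < 1], the only digit sum not exceeding [n r] is [0]. *)
    have a0 : (a i + a i)%:R = 0 :> R.
      suff -> : a i = 0%N by [].
      apply/eqP; rewrite -leqn0 -ltnS -(ltr_nat R).
      have : ((a i)%:R : R) <= (a i + a i)%:R by rewrite ler_nat leq_addr.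
      lra.
    rewrite a0 subr0 (@le_trans _ _ (n%:R * r i))//.
      by rewrite ler_pM2l // ge_min lexx.
    by rewrite le_min lexx; lra.
  (* As [n r > 2n - 1], the next remainder would exceed [2] for any digit sum
     below [2n - 2]. *)
  have aK : (a i + a i)%:R = 2 * n%:R - 2 :> R.
    rewrite -natrK; congr (_%:R); move: r'2; rewrite lerBlDl => r'2.
    have : ((n.-1.*2).-1%:R : R) < (a i + a i)%:R.
      rewrite -subn1 natrB ?natrK ?(ltnW K_gt0)//; lra.
    rewrite ltr_nat prednK ?(ltnW K_gt0)// => Ka.
    by apply/eqP; rewrite eqn_leq Ka andbT; lia.
  rewrite aK (@le_trans _ _ (n%:R * (2 - r i)))//.
    by rewrite ler_pM2l // ge_min lexx orbT.
  by rewrite le_min; apply/andP; split; lra.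
have wX i : n%:R ^+ i * w 0%N <= w i.
  elim: i => [|i IH]; first by rewrite expr0 mul1r.
  rewrite exprS -mulrA (le_trans _ (wS i))//.
  by rewrite ler_pM2l.
have w0 : 0 < w 0%N by rewrite lt_min z0 subr_gt0 z2.
pose i := Num.bound (2 / w 0%N).
have := upper_nthrootP (leqnn i); rewrite ltr_pdivrMr //; apply/negP.
rewrite -leNgt (@le_trans _ _ (n%:R ^+ i * w 0%N))//.
  by rewrite ler_pM2r // lerXn2r // nnegrE ltW.
by rewrite (le_trans (wX i)) // ge_min; case/andP: (r02 i) => _ ->.
Qed.

Lemma minkowski_sum_digit_set :
  minkowski_sum (digit_set R n A) (digit_set R n A) = `[0, 2]%classic.
Proof.
apply/seteqP; split => z /=; rewrite in_itv /=.
  move=> [x xC [y yC <-]].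
  have /andP[x0 x1] := digit_set_itv n_ge2 A_lt xC.
  have /andP[y0 y1] := digit_set_itv n_ge2 A_lt yC.
  by apply/andP; split; lra.
move=> /greedy_digits[a [b [r [rP <- rS]]]].
exists (limn (expansion R n a)).
  by apply: digit_set_lim => // i; case: (rP i).
exists (limn (expansion R n b)); last exact: greedy_sum.
by apply: digit_set_lim => // i; case: (rP i).
Qed.

(** The second representation exchanges the digits of both summands at a place
    where they differ. *)
Lemma not_unique_interior (z : R) : 0 < z < 2 -> ~ uniqueness_set R n A z.
Proof.
move=> /andP[z0 z2] [_ [[x y] [_ xy_uniq]]].
have [|a [b [r [rP r0 rS]]]] := @greedy_digits z; first by rewrite !ltW.
have [|j abj] := distinct_digit rP rS; first by rewrite r0 z0 z2.
have aA i : a i \in A by case: (rP i).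
have bA i : b i \in A by case: (rP i).
have an i := A_lt (aA i); have bn i := A_lt (bA i).
pose a' i := if i == j then b i else a i.
pose b' i := if i == j then a i else b i.
have pairP (c d : nat -> nat) : (forall i, c i \in A) -> (forall i, d i \in A) ->
    limn (expansion R n c) + limn (expansion R n d) = z ->
    (x, y) = (limn (expansion R n c), limn (expansion R n d)).
  by move=> cA dA cd; apply: xy_uniq; split => //=; exact: digit_set_lim.
have a'E := lim_expansion_swap R n_ge2 j an bn.
have b'E := lim_expansion_swap R n_ge2 j bn an.
have [xE _] := pairP _ _ aA bA (etrans (greedy_sum rP rS) r0).
have a'A i : a' i \in A by rewrite /a'; case: ifP.
have b'A i : b' i \in A by rewrite /b'; case: ifP.
have swapE : limn (expansion R n a') + limn (expansion R n b') = z.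
  by rewrite a'E b'E -r0 -(greedy_sum rP rS); ring.
have [xE' _] := pairP _ _ a'A b'A swapE.
move: xE'; rewrite xE a'E => /eqP; rewrite -subr_eq0 opprD addrA subrr sub0r.
rewrite oppr_eq0 mulf_eq0 invr_eq0 expf_eq0 (gt_eqF n_gt0) andbF orbF.
by rewrite subr_eq0 eqr_nat => /eqP /esym.
Qed.

Lemma uniqueness_set_endpoints : uniqueness_set R n A = [set 0; 2].
Proof.
have sumE := minkowski_sum_digit_set.
apply/seteqP; split => z.
  move=> zU; have [zS _] := zU; move: zS; rewrite sumE /= in_itv /= => /andP[z0 z2].
  have [|z_gt0] := leP z 0; first by left; apply/eqP; rewrite eq_le z0 andbT.
  have [|z_lt2] := leP 2 z; first by right; apply/eqP; rewrite eq_le z2.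
  by case: (not_unique_interior (z := z)); rewrite ?z_gt0.
(* Since the attractor lies in [0, 1], an extreme value [2 e] of [x + y]
   determines both summands. *)
have extremal e : (forall x y : R, 0 <= x <= 1 -> 0 <= y <= 1 -> x + y = 2 * e ->
    x = e /\ y = e) -> 0 <= e <= 1 -> uniqueness_set R n A (2 * e).
  move=> e_ext e01.
  have zS : minkowski_sum (digit_set R n A) (digit_set R n A) (2 * e).
    by rewrite sumE /= in_itv /=; lra.
  split => //; case: zS => x xC [y yC xyE].
  have [xe ye] := e_ext x y (digit_set_itv n_ge2 A_lt xC)
    (digit_set_itv n_ge2 A_lt yC) xyE.
  exists (x, y); split => // -[x' y'] /= [xC' yC' /esym xyE'].
  have [-> ->] := e_ext x' y' (digit_set_itv n_ge2 A_lt xC')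
    (digit_set_itv n_ge2 A_lt yC') xyE'.
  by rewrite xe ye.
case=> ->.
  by rewrite -[0](mulr0 2); apply: extremal => [x y|]; lra.
by rewrite -[2](mulr1 2); apply: extremal => [x y|]; lra.
Qed.

End sums.

Theorem corollary2p3 (R : realType) :
  exists2 K : R, 0 < K &
    forall n : nat, (2 <= n)%N ->
      exists A : {fset nat},
        [/\ good R n A,
            (#|` A|)%:R <= K * Num.sqrt (n%:R : R) &
            uniqueness_set R n A = [set 0; 2]].
Proof.
(* The constant is that of [card_thin_digits], where [m <= sqrt n]. *)
exists 8 => // n n2.
have [A [m [Adig Aspan mn cardA]]] := exists_thin_digits n2.
exists A; split; first by split => //; exact: minkowski_sum_digit_set.
  apply: (@le_trans _ _ (8 * m)%:R); first by rewrite ler_nat.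
  rewrite natrM ler_wpM2l // -[m%:R]ger0_norm // -sqrtr_sqr.
  by rewrite ler_wsqrtr // -natrX ler_nat.
exact: uniqueness_set_endpoints.
Qed.
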